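(* Let $G=\mathbb{Z}_2^3$ and let $F,F':G\times G\to\mathbb{R}^*$ be $$F(x,y)=(-1)^{x_1x_2y_3+x_1y_2x_3+y_1x_2x_3+\sum_{1\le i\le j\le 3}x_iy_j},\qquad F'(x,y)=(-1)^{\sum_{1\le i\le j\le 3}x_iy_j}.$$ Let $(\mathcal{F},\varphi_0,\varphi_2):\mathrm{Vec}_{G}^{\partial F}\to \mathrm{Vec}_{G}^{0}$ be given by $\mathcal{F}(U)=U$ (the identity on underlying graded spaces and morphisms), $\varphi_0=\mathrm{Id}_{\mathbb{R}}$, and $$\varphi_2:\ U\otimes V\to U\otimes V,\qquad u\otimes v\mapsto (-1)^{x_1x_2y_3+x_1y_2x_3+y_1x_2x_3}\,u\otimes v$$ for all objects $U,V$ and all $u\in U_x$, $v\in V_y$, $x,y\in G$. Then $(\mathcal{F},\varphi_0,\varphi_2)$ is a tensor equivalence, and $\mathcal{F}$ maps the algebra $\mathbb{O}=\mathbb{R}_F[G]$ in $\mathrm{Vec}_{G}^{\partial F}$ to the algebra $\mathrm{Cl}_{0,3}=\mathbb{R}_{F'}[G]$ in $\mathrm{Vec}_{G}^{0}$.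
   Context: All vector spaces are over $\mathbb{R}$. $\mathbb{Z}_2=\{0,1\}$, $G=\mathbb{Z}_2^3$ is written additively, and $x=(x_1,x_2,x_3)$, $y=(y_1,y_2,y_3)\in G$. For a normalized 3-cocycle $\Phi:G^3\to\mathbb{R}^*$, $\mathrm{Vec}_G^{\Phi}$ is the tensor category of finite-dimensional $G$-graded real vector spaces, with the usual graded tensor product, unit object $\mathbb{R}$ in degree $0$, and associativity constraint $(u\otimes v)\otimes w\mapsto \Phi(x,y,z)\,u\otimes(v\otimes w)$ for $u,v,w$ homogeneous of degrees $x,y,z$. $\mathrm{Vec}_G^0$ denotes the case of the trivial cocycle (constant function $1$). For a function $F:G\times G\to\mathbb{R}^*$ with $F(0,x)=F(x,0)=1$ (a 2-cochain), $\partial F(x,y,z)=\dfrac{F(x,y)F(x+y,z)}{F(x,y+z)F(y,z)}$. The twisted group algebra $\mathbb{R}_F[G]$ is the real vector space with basis $G$ (the basis element $x$ having degree $x$) and product $x\cdot y=F(x,y)(x+y)$, where on the right $x+y$ denotes the basis element indexed by the sum. An algebra in $\mathrm{Vec}_G^{\Phi}$ is a finite-dimensional $G$-graded space $A$ with a degree-preserving unital multiplication satisfying $(a\cdot b)\cdot c=\Phi(|a|,|b|,|c|)\,a\cdot(b\cdot c)$ for homogeneous $a,b,c$, where $|a|$ is the degree of $a$. The octonions $\mathbb{O}$ are identified with $\mathbb{R}_F[\mathbb{Z}_2^3]$, an algebra in $\mathrm{Vec}_{G}^{\partial F}$, and the real Clifford algebra $\mathrm{Cl}_{0,3}$ with $\mathbb{R}_{F'}[\mathbb{Z}_2^3]$,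 an algebra in $\mathrm{Vec}_G^{\partial F'}=\mathrm{Vec}_G^0$ (since $\partial F'$ is trivial). A tensor functor consists of a functor $\mathcal{F}$ with natural isomorphisms $\varphi_2:\mathcal{F}(U)\otimes\mathcal{F}(V)\to\mathcal{F}(U\otimes V)$ and an isomorphism $\varphi_0$ between unit objects, satisfying the usual associativity and unit coherence conditions. It maps an algebra $(A,m)$ to the algebra $\mathcal{F}(A)$ with multiplication $\mathcal{F}(m)\circ\varphi_2$ (and unit $\mathcal{F}(u)\circ\varphi_0$, where $u$ is the unit morphism of $A$). *)

(* Defs.v *)
From HB Require Import structures.
From mathcomp Require Import all_boot all_order all_algebra.
From mathcomp Require Import ring reals.

Set Implicit Arguments.
Unset Strict Implicit.
Unset Printing Implicit Defensive.

Import GRing.Theory.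
Local Open Scope ring_scope.

Record category := Category {
  obj :> Type;
  hom : obj -> obj -> Type;
  idm : forall U, hom U U;
  comp : forall U V W, hom V W -> hom U V -> hom U W;
  comp1m : forall U V (f : hom U V), comp (idm V) f = f;
  compm1 : forall U V (f : hom U V), comp f (idm U) = f;
  compA : forall U V W X (h : hom W X) (g : hom V W) (f : hom U V),
    comp h (comp g f) = comp (comp h g) f }.

Arguments hom {c} U V.
Arguments idm {c} U.
Arguments comp {c U V W} g f.

Declare Scope cat_scope.
Delimit Scope cat_scope with cat.
Notation "g \o f" := (comp g f) : cat_scope.
Local Open Scope cat_scope.

Definition is_iso (C : category) (U V : C) (f : hom U V) :=
  exists g : hom V U, g \o f = idm U /\ f \o g = idm V.

Record functor (C D : category) := Functor {
  fobj :> C -> D;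
  fmor : forall U V : C, hom U V -> hom (fobj U) (fobj V);
  fmor1 : forall U : C, fmor (idm U) = idm (fobj U);
  fmorM : forall (U V W : C) (g : hom V W) (f : hom U V),
    fmor (g \o f) = fmor g \o fmor f }.

Arguments fmor {C D} F {U V} f : rename.

Definition id_functor (C : category) : functor C C :=
  @Functor C C id (fun _ _ f => f) (fun _ => erefl) (fun _ _ _ _ _ => erefl).

Section CompFunctor.
Variables (C D E : category) (F' : functor D E) (F : functor C D).

Fact comp_functor1 (U : C) : fmor F' (fmor F (idm U)) = idm (F' (F U)).
Proof. by rewrite !fmor1. Qed.

Fact comp_functorM (U V W : C) (g : hom V W) (f : hom U V) :
  fmor F' (fmor F (g \o f)) = fmor F' (fmor F g) \o fmor F' (fmor F f).
Proof. by rewrite !fmorM. Qed.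

Definition comp_functor : functor C E :=
  @Functor C E (fun U => F' (F U)) (fun _ _ f => fmor F' (fmor F f))
    comp_functor1 comp_functorM.
End CompFunctor.

Record tensor_category := TensorCategory {
  tcat :> category;
  tobj : tcat -> tcat -> tcat;
  tmor : forall U U' V V' : tcat,
    hom U U' -> hom V V' -> hom (tobj U V) (tobj U' V');
  tone : tcat;
  assoc : forall U V W : tcat,
    hom (tobj (tobj U V) W) (tobj U (tobj V W));
  lunit : forall U : tcat, hom (tobj tone U) U;
  runit : forall U : tcat, hom (tobj U tone) U;
  tmor1 : forall U V : tcat, tmor (idm U) (idm V) = idm (tobj U V);
  tmorM : forall (U U' U'' V V' V'' : tcat) (f' : hom U' U'') (f : hom U U')
    (g' : hom V' V'') (g : hom V V'),
    tmor (f' \o f) (g' \o g) = tmor f' g' \o tmor f g;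
  assoc_iso : forall U V W, is_iso (assoc U V W);
  lunit_iso : forall U, is_iso (lunit U);
  runit_iso : forall U, is_iso (runit U);
  assoc_nat : forall (U U' V V' W W' : tcat)
    (f : hom U U') (g : hom V V') (h : hom W W'),
    assoc U' V' W' \o tmor (tmor f g) h
    = tmor f (tmor g h) \o assoc U V W;
  lunit_nat : forall (U U' : tcat) (f : hom U U'),
    lunit U' \o tmor (idm tone) f = f \o lunit U;
  runit_nat : forall (U U' : tcat) (f : hom U U'),
    runit U' \o tmor f (idm tone) = f \o runit U;
  pentagon : forall U V W X : tcat,
    assoc U V (tobj W X) \o assoc (tobj U V) W X
    = tmor (idm U) (assoc V W X)
      \o (assoc U (tobj V W) X \o tmor (assoc U V W) (idm X));
  triangle : forall U V : tcat,
    tmor (idm U) (lunit V) \o assoc U tone V = tmor (runit U) (idm V) }.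

Arguments tobj {t} U V.
Arguments tmor {t U U' V V'} f g.
Arguments tone {t}.
Arguments assoc {t} U V W.
Arguments lunit {t} U.
Arguments runit {t} U.

Notation "U \ox V" := (tobj U V) (at level 40, left associativity) : cat_scope.
Notation "f \oxm g" := (tmor f g) (at level 40, left associativity) : cat_scope.

(* A triple (F, phi_0, phi_2), not yet subject to the axioms of a tensor
   functor, which are those of [is_tensor_functor]. *)
Record tensor_triple (C D : tensor_category) := TensorTriple {
  tfun :> functor C D;
  phi0 : hom (tone : D) (tfun (tone : C));
  phi2 : forall U V : C, hom (tfun U \ox tfun V) (tfun (U \ox V)) }.

Arguments phi0 {C D} F : rename.
Arguments phi2 {C D} F U V : rename.

Record is_tensor_functor (C D : tensor_category) (F : tensor_triple C D) :
    Prop := IsTensorFunctor {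
  phi0_iso : is_iso (phi0 F);
  phi2_iso : forall U V, is_iso (phi2 F U V);
  phi2_nat : forall (U U' V V' : C) (f : hom U U') (g : hom V V'),
    phi2 F U' V' \o (fmor F f \oxm fmor F g)
    = fmor F (f \oxm g) \o phi2 F U V;
  phi2_assoc : forall U V W : C,
    fmor F (assoc U V W)
      \o (phi2 F (U \ox V) W \o (phi2 F U V \oxm idm (F W)))
    = phi2 F U (V \ox W)
      \o ((idm (F U) \oxm phi2 F V W) \o assoc (F U) (F V) (F W));
  phi2_lunit : forall U : C,
    fmor F (lunit U) \o (phi2 F tone U \o (phi0 F \oxm idm (F U)))
    = lunit (F U);
  phi2_runit : forall U : C,
    fmor F (runit U) \o (phi2 F U tone \o (idm (F U) \oxm phi0 F))
    = runit (F U) }.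

Definition id_tensor (C : tensor_category) : tensor_triple C C :=
  @TensorTriple C C (id_functor C) (idm tone) (fun U V => idm (U \ox V)).

Definition comp_tensor (C D E : tensor_category)
    (F' : tensor_triple D E) (F : tensor_triple C D) : tensor_triple C E :=
  @TensorTriple C E (comp_functor F' F) (fmor F' (phi0 F) \o phi0 F')
    (fun U V => fmor F' (phi2 F U V) \o phi2 F' (F U) (F V)).

Definition tensor_isomorphic (C D : tensor_category)
    (F F' : tensor_triple C D) : Prop :=
  exists eta : forall U : C, hom (F U) (F' U),
    [/\ forall U, is_iso (eta U),
        forall (U V : C) (f : hom U V),
          eta V \o fmor F f = fmor F' f \o eta U,
        eta tone \o phi0 F = phi0 F'
      & forall U V : C,
          eta (U \ox V) \o phi2 F U V = phi2 F' U V \o (eta U \oxm eta V)].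

Definition is_tensor_equivalence (C D : tensor_category)
    (F : tensor_triple C D) : Prop :=
  is_tensor_functor F /\
  exists F' : tensor_triple D C,
    [/\ is_tensor_functor F',
        tensor_isomorphic (id_tensor C) (comp_tensor F' F)
      & tensor_isomorphic (comp_tensor F F') (id_tensor D)].

(* An object A with a multiplication A \ox A -> A and a unit 1 -> A, as yet
   without axioms. *)
Record algebra_data (C : tensor_category) := AlgebraData {
  acarrier :> C;
  amul : hom (acarrier \ox acarrier) acarrier;
  aunit : hom (tone : C) acarrier }.

Definition image_algebra (C D : tensor_category) (F : tensor_triple C D)
    (A : algebra_data C) : algebra_data D :=
  @AlgebraData D (F A) (fmor F (amul A) \o phi2 F A A)
    (fmor F (aunit A) \o phi0 F).

Section TensorSpace.
Variable K : fieldType.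
Implicit Types U V W : vectType K.

(* Coordinates of a tensor in the basis (b_i (x) c_j), where b and c are the
   bases [vbasis {:U}] and [vbasis {:V}]; [tliftE] and [tens_ext] below give
   the universal property. *)
Definition tspace U V : vectType K := 'M[K]_(\dim {:U}, \dim {:V}).

Definition tens U V (u : U) (v : V) : tspace U V :=
  \matrix_(i, j) (coord (vbasis {:U}) i u * coord (vbasis {:V}) j v).

Definition bilin U V W (f : U -> V -> W) :=
  (forall v, linear (f^~ v)) /\ (forall u, linear (f u)).

Definition tlift U V W (f : U -> V -> W) : 'Hom(tspace U V, W) :=
  linfun (fun t : tspace U V => \sum_i \sum_j
    t i j *: f (vbasis {:U})`_i (vbasis {:V})`_j).

Lemma tens_bilin U V : bilin (@tens U V).
Proof.
split=> [v|u] a x y; apply/matrixP=> i j; rewrite !mxE linearP /=.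
  by rewrite mulrDl mulrA.
by rewrite mulrDr mulrCA.
Qed.

Fact tlift_linear U V W (f : U -> V -> W) :
  linear (fun t : tspace U V => \sum_i \sum_j
    t i j *: f (vbasis {:U})`_i (vbasis {:V})`_j).
Proof.
move=> a s t; rewrite scaler_sumr -big_split; apply: eq_bigr => i _ /=.
rewrite scaler_sumr -big_split; apply: eq_bigr => j _ /=.
by rewrite !mxE scalerDl scalerA.
Qed.

Lemma tliftEmx U V W (f : U -> V -> W) t : tlift f t =
  \sum_i \sum_j t i j *: f (vbasis {:U})`_i (vbasis {:V})`_j.
Proof.
pose g := GRing.isLinear.Build _ _ _ _ _ (tlift_linear f).
pose h : {linear tspace U V -> W} := HB.pack (fun t : tspace U V =>
  \sum_i \sum_j t i j *: f (vbasis {:U})`_i (vbasis {:V})`_j) g.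
exact: (lfunE h).
Qed.

Lemma bilin_suml U V W (f : U -> V -> W) (I : finType) (P : pred I) c us v :
  bilin f -> f (\sum_(i | P i) c i *: us i) v = \sum_(i | P i) c i *: f (us i) v.
Proof.
case=> fl _; pose h : {linear U -> W} :=
  HB.pack (f^~ v) (GRing.isLinear.Build _ _ _ _ _ (fl v)).
rewrite -[LHS]/(h _) linear_sum; apply: eq_bigr => i _; exact: linearZ.
Qed.

Lemma bilin_sumr U V W (f : U -> V -> W) (I : finType) (P : pred I) c u vs :
  bilin f -> f u (\sum_(i | P i) c i *: vs i) = \sum_(i | P i) c i *: f u (vs i).
Proof.
case=> _ fr; pose h : {linear V -> W} :=
  HB.pack (f u) (GRing.isLinear.Build _ _ _ _ _ (fr u)).
rewrite -[LHS]/(h _) linear_sum; apply: eq_bigr => i _; exact: linearZ.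
Qed.

Lemma tliftE U V W (f : U -> V -> W) u v :
  bilin f -> tlift f (tens u v) = f u v.
Proof.
move=> bf; rewrite tliftEmx.
rewrite [in RHS](coord_vbasis (memvf u)) [in RHS](coord_vbasis (memvf v)).
rewrite bilin_suml //; apply: eq_bigr => i _.
rewrite bilin_sumr // scaler_sumr; apply: eq_bigr => j _.
by rewrite mxE scalerA.
Qed.

Lemma tens_sum U V (t : tspace U V) :
  t = \sum_i \sum_j t i j *: tens (vbasis {:U})`_i (vbasis {:V})`_j.
Proof.
rewrite [LHS]matrix_sum_delta; apply: eq_bigr => i _; apply: eq_bigr => j _.
congr (_ *: _); apply/matrixP=> k l; rewrite !mxE.
have cb (X : vectType K) (a b : 'I_(\dim {:X})) :
    coord (vbasis {:X}) a (vbasis {:X})`_b = (a == b)%:R.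
  by rewrite coord_free ?(basis_free (vbasisP _)) // eq_sym.
by rewrite !cb -natrM mulnb.
Qed.

Lemma tens_ext U V W (f g : 'Hom(tspace U V, W)) :
  (forall u v, f (tens u v) = g (tens u v)) -> f = g.
Proof.
move=> fg; apply/lfunP=> t; rewrite (tens_sum t) !linear_sum.
apply: eq_bigr => i _; rewrite !linear_sum; apply: eq_bigr => j _.
by rewrite !linearZ /= fg.
Qed.

Lemma tens_suml U V (I : finType) (P : pred I) us (v : V) :
  tens (\sum_(i | P i) us i : U) v = \sum_(i | P i) tens (us i) v.
Proof.
apply/matrixP=> i j; rewrite mxE linear_sum mulr_suml summxE.
by apply: eq_bigr => k _; rewrite mxE.
Qed.

Lemma tens_sumr U V (I : finType) (P : pred I) (u : U) vs :
  tens u (\sum_(i | P i) vs i : V) = \sum_(i | P i) tens u (vs i).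
Proof.
apply/matrixP=> i j; rewrite mxE linear_sum mulr_sumr summxE.
by apply: eq_bigr => k _; rewrite mxE.
Qed.

Lemma tensZl U V a (u : U) (v : V) : tens (a *: u) v = a *: tens u v.
Proof.
apply/matrixP=> i j; rewrite !mxE linearZ /= mulrA //.
Qed.

Lemma tensZr U V a (u : U) (v : V) : tens u (a *: v) = a *: tens u v.
Proof.
apply/matrixP=> i j; rewrite !mxE linearZ /= mulrCA //.
Qed.

Definition tensv U V (A : {vspace U}) (B : {vspace V}) : {vspace tspace U V} :=
  <<[seq tens u v | u <- vbasis A, v <- vbasis B]>>%VS.

Lemma mem_tensv U V (A : {vspace U}) (B : {vspace V}) u v :
  u \in A -> v \in B -> tens u v \in tensv A B.
Proof.
move=> Au Bv; rewrite (coord_vbasis Au) (coord_vbasis Bv).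
rewrite tens_suml memv_suml // => i _; rewrite tens_sumr memv_suml // => j _.
rewrite tensZl tensZr !memvZ // memv_span //.
by apply/allpairsP; exists ((vbasis A)`_i, (vbasis B)`_j);
  rewrite !mem_nth ?size_tuple.
Qed.

Lemma tensv_sub U V (A : {vspace U}) (B : {vspace V}) (C : {vspace tspace U V}) :
  (forall u v, u \in A -> v \in B -> tens u v \in C) -> (tensv A B <= C)%VS.
Proof.
move=> ABC; apply/span_subvP=> t /allpairsP[[u v] /= [Au Bv ->]].
by apply: ABC; apply: vbasis_mem.
Qed.

End TensorSpace.

Section Graded.
Variables (K : fieldType) (G : finZmodType).

(* Stated for a variable family because [directv] looks through the syntactic
   form of the summands. *)
Definition direct_family (V : vectType K) (Us : G -> {vspace V}) : bool :=
  directv (\sum_x Us x).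

Record gvect := GVect {
  gsp :> vectType K;
  gr : G -> {vspace gsp};
  gr_full : (\sum_x gr x)%VS = fullv;
  gr_direct : direct_family gr }.

Arguments gr U x : rename.
Implicit Types U V W X : gvect.

Definition hproj U (x : G) : 'End(U) := sumv_pi (\sum_x gr U x)%VS x.

Lemma hproj_mem U x u : hproj U x u \in gr U x.
Proof. exact: memv_sum_pi. Qed.

Lemma hproj_sum U u : \sum_x hproj U x u = u.
Proof. by apply: sumv_pi_sum; rewrite gr_full memvf. Qed.

Lemma hprojE U x y u : u \in gr U y -> hproj U x u = if x == y then u else 0.
Proof.
move=> uy; have/directv_sum_unique := gr_direct U.
move=> /(_ (fun x => hproj U x u) (fun x => if x == y then u else 0)) H.
apply/eqP; have: [forall (z | true), hproj U z u == if z == y then u else 0].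
  rewrite -H; first by rewrite hproj_sum -big_mkcond big_pred1_eq.
    by move=> z _; apply: hproj_mem.
  by move=> z _; case: eqP => [->|_]; rewrite ?mem0v.
by move/forallP/(_ x).
Qed.

Lemma sum_hprojE U (V : vectType K) (f : G -> U -> V) y u :
  (forall x, f x 0 = 0) -> u \in gr U y -> \sum_x f x (hproj U x u) = f y u.
Proof.
move=> f0 uy; rewrite (bigD1 y) //= big1 ?addr0 => [|x xy].
  by rewrite (hprojE _ uy) eqxx.
by rewrite (hprojE _ uy) (negPf xy).
Qed.

Fact directv_proj (V : vectType K) (Us : G -> {vspace V}) (P : G -> 'End(V)) :
  (forall z z' w, w \in Us z' -> P z w = if z == z' then w else 0) ->
  direct_family Us.
Proof.
move=> PE; apply/directv_sum_independent => us Uu u0 z _.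
have := congr1 (P z) u0; rewrite linear0 linear_sum (bigD1 z) //= big1.
  by rewrite (PE _ _ _ (Uu z isT)) eqxx addr0.
by move=> j jz; rewrite (PE _ _ _ (Uu j isT)) eq_sym (negPf jz).
Qed.

Definition degree_preserving U V (f : 'Hom(U, V)) : bool :=
  [forall x, (f @: gr U x <= gr V x)%VS].

Record ghom U V := GHom {
  glin :> 'Hom(U, V);
  ghom_deg : degree_preserving glin }.

Lemma ghomP U V (f : 'Hom(U, V)) :
  (forall x u, u \in gr U x -> f u \in gr V x) ->
  degree_preserving f.
Proof.
move=> fP; apply/forallP=> x; apply/subvP=> _ /memv_imgP[u ux ->].
exact: fP.
Qed.

Lemma ghom_mem U V (f : ghom U V) x u : u \in gr U x -> f u \in gr V x.
Proof.
move=> ux; have /forallP/(_ x)/subvP := ghom_deg f; apply.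
exact: memv_img.
Qed.

Lemma ghom_inj U V (f g : ghom U V) : glin f = glin g -> f = g.
Proof.
case: f g => f fP [g gP] /= E; case: g / E gP => gP.
by rewrite (bool_irrelevance fP gP).
Qed.

Fact id_ghom_deg U : degree_preserving (\1%VF : 'End(U)).
Proof. by apply: ghomP => x u; rewrite id_lfunE. Qed.
Definition id_ghom U : ghom U U := GHom (id_ghom_deg U).

Fact comp_ghom_deg U V W (g : ghom V W) (f : ghom U V) :
  degree_preserving (glin g \o glin f)%VF.
Proof. by apply: ghomP => x u ux; rewrite comp_lfunE !ghom_mem. Qed.
Definition comp_ghom U V W (g : ghom V W) (f : ghom U V) : ghom U W :=
  GHom (comp_ghom_deg g f).

Fact comp1_ghom U V (f : ghom U V) : comp_ghom (id_ghom V) f = f.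
Proof. by apply: ghom_inj; rewrite /= comp_lfun1l. Qed.
Fact comp_ghom1 U V (f : ghom U V) : comp_ghom f (id_ghom U) = f.
Proof. by apply: ghom_inj; rewrite /= comp_lfun1r. Qed.
Fact comp_ghomA U V W X (h : ghom W X) (g : ghom V W) (f : ghom U V) :
  comp_ghom h (comp_ghom g f) = comp_ghom (comp_ghom h g) f.
Proof. by apply: ghom_inj; rewrite /= comp_lfunA. Qed.

Definition gvect_cat : category :=
  @Category gvect ghom id_ghom comp_ghom comp1_ghom comp_ghom1 comp_ghomA.

Definition tensor_gr U V (z : G) : {vspace tspace U V} :=
  (\sum_(p : G * G | (p.1 + p.2)%R == z) tensv (gr U p.1) (gr V p.2))%VS.

Lemma tensor_gr_mem U V x y u v :
  u \in gr U x -> v \in gr V y -> tens u v \in tensor_gr U V (x + y).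
Proof.
move=> ux vy; have := mem_tensv ux vy; apply/subvP.
by rewrite /tensor_gr (sumv_sup (x, y)) /= ?eqxx ?subvv.
Qed.

Lemma tensor_gr_sub U V z (C : {vspace tspace U V}) :
  (forall x y u v, x + y = z -> u \in gr U x -> v \in gr V y -> tens u v \in C) ->
  (tensor_gr U V z <= C)%VS.
Proof.
move=> H; apply/subv_sumP=> -[x y] /= /eqP xyz; apply: tensv_sub => u v.
exact: H.
Qed.

Lemma tensor_gr_img U V (W : vectType K) z (f : 'Hom(tspace U V, W))
    (C : {vspace W}) t :
  (forall x y u v, x + y = z -> u \in gr U x -> v \in gr V y ->
     f (tens u v) \in C) ->
  t \in tensor_gr U V z -> f t \in C.
Proof.
move=> H tz; have /subvP/(_ _ tz) : (tensor_gr U V z <= f @^-1: C)%VS.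
  by apply: tensor_gr_sub => x y u v *; rewrite -memv_preim; apply: H; eauto.
by rewrite memv_preim.
Qed.

Lemma tens_hproj U V (u : U) (v : V) :
  tens u v = \sum_x \sum_y tens (hproj U x u) (hproj V y v).
Proof.
rewrite -{1}[u]hproj_sum tens_suml; apply: eq_bigr => x _.
by rewrite -{1}[v]hproj_sum tens_sumr.
Qed.

Fact tensor_gr_full U V : (\sum_z tensor_gr U V z)%VS = fullv.
Proof.
apply/eqP; rewrite eqEsubv subvf; apply/subvP=> t _; rewrite (tens_sum t).
apply: memv_suml => i _; apply: memv_suml => j _; apply: memvZ.
rewrite tens_hproj; apply: memv_suml => x _; apply: memv_suml => y _.
have := tensor_gr_mem (hproj_mem x (vbasis {:U})`_i)
                      (hproj_mem y (vbasis {:V})`_j).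
by apply/subvP; apply: (sumv_sup (x + y)).
Qed.

(* The endomorphism u (x) v |-> c x y (u (x) v) for u, v homogeneous of
   degrees x, y; see [twistE]. *)
Definition twist (c : G -> G -> K) U V : 'End(tspace U V) :=
  tlift (fun u v => \sum_x \sum_y c x y *: tens (hproj U x u) (hproj V y v)).

Fact twist_bilin c U V : bilin (fun (u : U) (v : V) =>
  \sum_x \sum_y c x y *: tens (hproj U x u) (hproj V y v)).
Proof.
have [tl tr] := @tens_bilin K U V.
split=> w a s t; rewrite scaler_sumr -big_split; apply: eq_bigr => x _;
  rewrite scaler_sumr -big_split; apply: eq_bigr => y _ /=;
  by rewrite linearP ?tl ?tr scalerDr !scalerA (mulrC a).
Qed.

Lemma tens0l (U V : vectType K) (v : V) : tens (0 : U) v = 0.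
Proof. by rewrite -(scale0r 0) tensZl scale0r. Qed.

Lemma tens0r (U V : vectType K) (u : U) : tens u (0 : V) = 0.
Proof. by rewrite -(scale0r 0) tensZr scale0r. Qed.

Lemma twistE c U V x y u v : u \in gr U x -> v \in gr V y ->
  twist c U V (tens u v) = c x y *: tens u v.
Proof.
move=> ux vy; rewrite tliftE; last exact: twist_bilin.
rewrite (@sum_hprojE U _ (fun x u => \sum_y c x y *: tens u (hproj V y v)) x) //.
  by rewrite (@sum_hprojE V _ (fun y v => c x y *: tens u v) y) // => ?;
     rewrite tens0r scaler0.
by move=> x'; rewrite big1 // => y' _; rewrite tens0l scaler0.
Qed.

Fact tensor_gr_direct U V : direct_family (tensor_gr U V).
Proof.
apply: (@directv_proj _ _
  (fun z => twist (fun x y => (x + y == z)%:R) U V)) => z z' w wz.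
pose a : K := (z == z')%:R.
have : twist (fun x y => (x + y == z)%:R) U V w - a *: w \in 0%VS.
  have := @tensor_gr_img U V _ z'
    (twist (fun x y => (x + y == z)%:R) U V - a *: \1)%VF 0%VS w.
  rewrite !lfun_simp; apply=> // x y u v xyz' ux vy.
  by rewrite !lfun_simp (twistE _ ux vy) xyz' (eq_sym z') subrr mem0v.
rewrite memv0 subr_eq0 => /eqP->; rewrite /a.
by case: eqP => _; rewrite ?scale1r ?scale0r.
Qed.

Definition gtensor U V : gvect :=
  GVect (tensor_gr_full U V) (tensor_gr_direct U V).

Definition lfun_tensor (U U' V V' : vectType K) (f : 'Hom(U, U')) (g : 'Hom(V, V')) :
  'Hom(tspace U V, tspace U' V') := tlift (fun u v => tens (f u) (g v)).

Lemma lfun_tensorE (U U' V V' : vectType K) (f : 'Hom(U, U')) (g : 'Hom(V, V')) u v :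
  lfun_tensor f g (tens u v) = tens (f u) (g v).
Proof.
have [tl tr] := @tens_bilin K U' V'.
by rewrite tliftE //; split=> w a s t; rewrite linearP ?tl ?tr.
Qed.

Fact ghom_tensor_deg U U' V V' (f : ghom U U') (g : ghom V V') :
  @degree_preserving (gtensor U V) (gtensor U' V') (lfun_tensor f g).
Proof.
apply: (@ghomP (gtensor U V) (gtensor U' V')) => z t; apply: tensor_gr_img => x y u v <- ux vy.
by rewrite lfun_tensorE; apply: tensor_gr_mem; apply: ghom_mem.
Qed.
Definition ghom_tensor U U' V V' (f : ghom U U') (g : ghom V V') :
  ghom (gtensor U V) (gtensor U' V') := GHom (ghom_tensor_deg f g).

Fact gtwist_deg c U V :
  @degree_preserving (gtensor U V) (gtensor U V) (twist c U V).
Proof.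
apply: (@ghomP (gtensor U V) (gtensor U V)) => z t; apply: tensor_gr_img => x y u v <- ux vy.
by rewrite (twistE _ ux vy); apply: memvZ; apply: tensor_gr_mem.
Qed.
Definition gtwist (c : G -> G -> K) U V : ghom (gtensor U V) (gtensor U V) :=
  GHom (gtwist_deg c U V).

Definition gunit_gr (x : G) : {vspace K^o} := if x == 0 then fullv else 0%VS.

Fact gunit_full : (\sum_x gunit_gr x)%VS = fullv.
Proof. by rewrite /gunit_gr -big_mkcond big_pred1_eq. Qed.

Fact gunit_direct : direct_family gunit_gr.
Proof.
apply: (@directv_proj _ _ (fun z => if z == 0 then \1%VF else 0)) => z z' w.
rewrite /gunit_gr; case: (z' =P 0) => [->|/eqP z'0] /=.
  by move=> _; case: eqP => _; rewrite lfun_simp.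
by rewrite memv0 => /eqP->; rewrite linear0 if_same.
Qed.

Definition gunit : gvect := GVect gunit_full gunit_direct.

Lemma gunit0 (r : gunit) : r \in gr gunit 0.
Proof. by rewrite /= /gunit_gr eqxx memvf. Qed.

Lemma gunitP x (r : gunit) : r \in gr gunit x -> x = 0 \/ r = 0.
Proof.
rewrite /= /gunit_gr; case: eqP => [|_]; first by left.
by rewrite memv0 => /eqP; right.
Qed.

Definition lunit_lfun U : 'Hom(tspace K^o U, U) :=
  tlift (fun (r : K^o) (u : U) => (r : K) *: u).

Definition runit_lfun U : 'Hom(tspace U K^o, U) :=
  tlift (fun (u : U) (r : K^o) => (r : K) *: u).

Lemma lunitE U (r : K^o) (u : U) : lunit_lfun U (tens r u) = (r : K) *: u.
Proof.
rewrite tliftE //; split=> w a s t; first by rewrite scalerDl -scalerA.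
by rewrite scalerDr !scalerA mulrC.
Qed.

Lemma runitE U (r : K^o) (u : U) : runit_lfun U (tens u r) = (r : K) *: u.
Proof.
rewrite tliftE //; split=> w a s t; last by rewrite scalerDl -scalerA.
by rewrite scalerDr !scalerA mulrC.
Qed.

Fact lunit_deg U :
  @degree_preserving (gtensor gunit U) U (lunit_lfun U).
Proof.
apply: (@ghomP (gtensor gunit U) (U)) => z t; apply: tensor_gr_img => x y r u <- rx uy.
rewrite lunitE; case: (gunitP rx) => ->; last by rewrite scale0r mem0v.
by rewrite add0r memvZ.
Qed.
Definition glunit U : ghom (gtensor gunit U) U := GHom (lunit_deg U).

Fact runit_deg U :
  @degree_preserving (gtensor U gunit) U (runit_lfun U).
Proof.
apply: (@ghomP (gtensor U gunit) (U)) => z t; apply: tensor_gr_img => x y u r <- ux ry.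
rewrite runitE; case: (gunitP ry) => ->; last by rewrite scale0r mem0v.
by rewrite addr0 memvZ.
Qed.
Definition grunit U : ghom (gtensor U gunit) U := GHom (runit_deg U).

Definition tensl (U V : vectType K) (v : V) : 'Hom(U, tspace U V) :=
  linfun (fun u => tens u v).
Definition tensr (U V : vectType K) (u : U) : 'Hom(V, tspace U V) :=
  linfun (fun v => tens u v).

Lemma tenslE (U V : vectType K) (v : V) (u : U) : tensl U v u = tens u v.
Proof.
pose h : {linear U -> tspace U V} := HB.pack (fun u => tens u v)
  (GRing.isLinear.Build _ _ _ _ _ ((@tens_bilin K U V).1 v)).
exact: (lfunE h).
Qed.

Lemma tensrE (U V : vectType K) (v : V) (u : U) : tensr V u v = tens u v.
Proof.
pose h : {linear V -> tspace U V} := HB.pack (fun v => tens u v)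
  (GRing.isLinear.Build _ _ _ _ _ ((@tens_bilin K U V).2 u)).
exact: (lfunE h).
Qed.

Lemma gext U (W : vectType K) (f g : 'Hom(U, W)) :
  (forall x u, u \in gr U x -> f u = g u) -> f = g.
Proof.
move=> fg; apply/lfunP=> u; rewrite -[u]hproj_sum !linear_sum.
by apply: eq_bigr => x _; apply: fg; apply: hproj_mem.
Qed.

Lemma gext_l (U : vectType K) V (W : vectType K) (f g : 'Hom(tspace U V, W)) :
  (forall y v, v \in gr V y -> (f \o tensl U v = g \o tensl U v)%VF) -> f = g.
Proof.
move=> fg; apply: tens_ext => u v; rewrite -!tensrE -!comp_lfunE.
congr (fun_of_lfun _ v); apply: gext => y {}v vy.
by have /lfunP/(_ u) := fg y v vy; rewrite !comp_lfunE tenslE tensrE.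
Qed.

Lemma gext_r U (V W : vectType K) (f g : 'Hom(tspace U V, W)) :
  (forall x u, u \in gr U x -> (f \o tensr V u = g \o tensr V u)%VF) -> f = g.
Proof.
move=> fg; apply: tens_ext => u v; rewrite -!tenslE -!comp_lfunE.
congr (fun_of_lfun _ u); apply: gext => x {}u ux.
by have /lfunP/(_ v) := fg x u ux; rewrite !comp_lfunE tensrE tenslE.
Qed.

Lemma gext2 U V (W : vectType K) (f g : 'Hom(tspace U V, W)) :
  (forall x y u v, u \in gr U x -> v \in gr V y ->
     f (tens u v) = g (tens u v)) -> f = g.
Proof.
move=> fg; apply: gext_l => y v vy; apply: gext => x u ux.
by rewrite !comp_lfunE tenslE; apply: fg ux vy.
Qed.

Lemma gext3 U V W (X : vectType K) (f g : 'Hom(tspace (tspace U V) W, X)) :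
  (forall x y z u v w, u \in gr U x -> v \in gr V y -> w \in gr W z ->
     f (tens (tens u v) w) = g (tens (tens u v) w)) -> f = g.
Proof.
move=> fg; apply: gext_l => z w wz; apply: gext2 => x y u v ux vy.
by rewrite !comp_lfunE tenslE; apply: fg ux vy wz.
Qed.

Lemma gext3r U V W (X : vectType K) (f g : 'Hom(tspace U (tspace V W), X)) :
  (forall x y z u v w, u \in gr U x -> v \in gr V y -> w \in gr W z ->
     f (tens u (tens v w)) = g (tens u (tens v w))) -> f = g.
Proof.
move=> fg; apply: gext_r => x u ux; apply: gext2 => y z v w vy wz.
by rewrite !comp_lfunE tensrE; apply: fg ux vy wz.
Qed.

Lemma gext4 U V W X (Y : vectType K)
    (f g : 'Hom(tspace (tspace (tspace U V) W) X, Y)) :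
  (forall x y z t u v w s,
     u \in gr U x -> v \in gr V y -> w \in gr W z -> s \in gr X t ->
     f (tens (tens (tens u v) w) s) = g (tens (tens (tens u v) w) s)) -> f = g.
Proof.
move=> fg; apply: gext_l => t s st; apply: gext3 => x y z u v w ux vy wz.
by rewrite !comp_lfunE tenslE; apply: fg ux vy wz st.
Qed.

(* The map (u (x) v) (x) w |-> c x y z (u (x) (v (x) w)) for u, v, w homogeneous
   of degrees x, y, z, and the analogous map in the opposite direction; see
   [assoc_lfunE] and [assocV_lfunE]. *)
Definition assoc_lfun (c : G -> G -> G -> K) U V W :
    'Hom(tspace (tspace U V) W, tspace U (tspace V W)) :=
  tlift (fun t w => tlift (fun u v => \sum_x \sum_y \sum_z c x y z *:
    tens (hproj U x u) (tens (hproj V y v) (hproj W z w))) t).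

Definition assocV_lfun (c : G -> G -> G -> K) U V W :
    'Hom(tspace U (tspace V W), tspace (tspace U V) W) :=
  tlift (fun u t => tlift (fun v w => \sum_x \sum_y \sum_z c x y z *:
    tens (tens (hproj U x u) (hproj V y v)) (hproj W z w)) t).

Lemma tlift_lin (U V W : vectType K) a (f g h : U -> V -> W) t :
  (forall u v, f u v = a *: g u v + h u v) ->
  tlift f t = a *: tlift g t + tlift h t.
Proof.
move=> E; rewrite !tliftEmx scaler_sumr -big_split; apply: eq_bigr => i _ /=.
rewrite scaler_sumr -big_split; apply: eq_bigr => j _ /=.
by rewrite E scalerDr !scalerA mulrC.
Qed.

Section Trilin.
Variables (U V W : gvect) (X : vectType K) (c : G -> G -> G -> K).
Variable T : U -> V -> W -> X.
Hypothesis T1 : forall v w, linear (fun u => T u v w).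
Hypothesis T2 : forall u w, linear (fun v => T u v w).
Hypothesis T3 : forall u v, linear (fun w => T u v w).

Let S u v w := \sum_x \sum_y \sum_z
  c x y z *: T (hproj U x u) (hproj V y v) (hproj W z w).

Fact trilin1 v w : linear (fun u => S u v w).
Proof.
move=> a s t; rewrite /S; do 3![rewrite scaler_sumr -big_split; apply: eq_bigr => ? _ /=].
by rewrite linearP T1 scalerDr !scalerA (mulrC a).
Qed.

Fact trilin2 u w : linear (fun v => S u v w).
Proof.
move=> a s t; rewrite /S; do 3![rewrite scaler_sumr -big_split; apply: eq_bigr => ? _ /=].
by rewrite linearP T2 scalerDr !scalerA (mulrC a).
Qed.

Fact trilin3 u v : linear (fun w => S u v w).
Proof.
move=> a s t; rewrite /S; do 3![rewrite scaler_sumr -big_split; apply: eq_bigr => ? _ /=].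
by rewrite linearP T3 scalerDr !scalerA (mulrC a).
Qed.

Fact trilinE x y z u v w : u \in gr U x -> v \in gr V y -> w \in gr W z ->
  S u v w = c x y z *: T u v w.
Proof.
have lin0 (A : vectType K) (f : A -> X) : linear f -> f 0 = 0.
  by move=> /(_ (-1) 0 0); rewrite scaler0 addr0 scaleN1r addNr.
have T10 v' w' : T 0 v' w' = 0 by exact: (lin0 _ _ (T1 v' w')).
have T20 u' w' : T u' 0 w' = 0 by exact: (lin0 _ _ (T2 u' w')).
have T30 u' v' : T u' v' 0 = 0 by exact: (lin0 _ _ (T3 u' v')).
move=> ux vy wz; rewrite /S.
rewrite (@sum_hprojE U _ (fun x u => \sum_y \sum_z
  c x y z *: T u (hproj V y v) (hproj W z w)) x) //; last first.
  by move=> ?; do 2![rewrite big1 // => ? _]; rewrite T10 scaler0.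
rewrite (@sum_hprojE V _ (fun y v => \sum_z
  c x y z *: T u v (hproj W z w)) y) //; last first.
  by move=> ?; rewrite big1 // => ? _; rewrite T20 scaler0.
rewrite (@sum_hprojE W _ (fun z w => c x y z *: T u v w) z) // => ?.
by rewrite T30 scaler0.
Qed.

Fact tlift_trilin_l u v w :
  tlift (fun (t : tspace U V) w => tlift (fun u v => S u v w) t)
    (tens (tens u v) w) = S u v w.
Proof.
rewrite tliftE; first by rewrite tliftE //; split=> ?; [exact: trilin1|exact: trilin2].
split=> [w' | t] a r s; first by rewrite linearP.
by apply: tlift_lin => u' v'; rewrite trilin3.
Qed.

Fact tlift_trilin_r u v w :
  tlift (fun u (t : tspace V W) => tlift (fun v w => S u v w) t)
    (tens u (tens v w)) = S u v w.
Proof.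
rewrite tliftE; first by rewrite tliftE //; split=> ?; [exact: trilin2|exact: trilin3].
split=> [t | u'] a r s; last by rewrite linearP.
by apply: tlift_lin => v' w'; rewrite trilin1.
Qed.
End Trilin.

Lemma assoc_lfunE c U V W x y z u v w :
  u \in gr U x -> v \in gr V y -> w \in gr W z ->
  assoc_lfun c U V W (tens (tens u v) w) = c x y z *: tens u (tens v w).
Proof.
have [lA rA] := @tens_bilin K U (tspace V W).
have [lB rB] := @tens_bilin K V W.
move=> ux vy wz; rewrite /assoc_lfun.
have T2 (u' : U) (w' : W) : linear (fun v' : V => tens u' (tens v' w')).
  by move=> a s t; rewrite lB rA.
have T3 (u' : U) (v' : V) : linear (fun w' : W => tens u' (tens v' w')).
  by move=> a s t; rewrite rB rA.
have T1 (v' : V) (w' : W) := lA (tens v' w').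
rewrite (@tlift_trilin_l U V W _ c (fun u v w => tens u (tens v w)) T1 T2 T3).
exact: (@trilinE U V W _ c (fun u v w => tens u (tens v w)) T1 T2 T3).
Qed.

Lemma assocV_lfunE c U V W x y z u v w :
  u \in gr U x -> v \in gr V y -> w \in gr W z ->
  assocV_lfun c U V W (tens u (tens v w)) = c x y z *: tens (tens u v) w.
Proof.
have [lA rA] := @tens_bilin K (tspace U V) W.
have [lB rB] := @tens_bilin K U V.
move=> ux vy wz; rewrite /assocV_lfun.
have T1 (v' : V) (w' : W) : linear (fun u' : U => tens (tens u' v') w').
  by move=> a s t; rewrite lB lA.
have T2 (u' : U) (w' : W) : linear (fun v' : V => tens (tens u' v') w').
  by move=> a s t; rewrite rB lA.
have T3 (u' : U) (v' : V) := rA (tens u' v').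
rewrite (@tlift_trilin_r U V W _ c (fun u v w => tens (tens u v) w) T1 T2 T3).
exact: (@trilinE U V W _ c (fun u v w => tens (tens u v) w) T1 T2 T3).
Qed.

Fact gassoc_deg c U V W : @degree_preserving
  (gtensor (gtensor U V) W) (gtensor U (gtensor V W)) (assoc_lfun c U V W).
Proof.
apply: (@ghomP (gtensor (gtensor U V) W) (gtensor U (gtensor V W))) => s t; apply: tensor_gr_img => xy z p w <- pxy wz.
rewrite -tenslE -comp_lfunE; apply: tensor_gr_img pxy => x y u v <- ux vy.
rewrite comp_lfunE tenslE (assoc_lfunE _ ux vy wz) -addrA memvZ //.
by apply: (@tensor_gr_mem U (gtensor V W)) => //; apply: tensor_gr_mem.
Qed.
Definition gassoc c U V W :
  ghom (gtensor (gtensor U V) W) (gtensor U (gtensor V W)) :=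
  GHom (gassoc_deg c U V W).

Fact gassocV_deg c U V W : @degree_preserving
  (gtensor U (gtensor V W)) (gtensor (gtensor U V) W) (assocV_lfun c U V W).
Proof.
apply: (@ghomP (gtensor U (gtensor V W)) (gtensor (gtensor U V) W)) => s t; apply: tensor_gr_img => x yz u p <- ux pyz.
rewrite -tensrE -comp_lfunE; apply: tensor_gr_img pyz => y z v w <- vy wz.
rewrite comp_lfunE tensrE (assocV_lfunE _ ux vy wz) addrA memvZ //.
by apply: (@tensor_gr_mem (gtensor U V) W) => //; apply: tensor_gr_mem.
Qed.
Definition gassocV c U V W :
  ghom (gtensor U (gtensor V W)) (gtensor (gtensor U V) W) :=
  GHom (gassocV_deg c U V W).

End Graded.

(* Functions into the multiplicative group of K are functions into K without
   zeros. *)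
Record cochain2 (K : fieldType) (G : finZmodType) := Cochain2 {
  cochain_fun :> G -> G -> K;
  cochain_neq0 : forall x y, cochain_fun x y != 0;
  cochain_0x : forall x, cochain_fun 0 x = 1;
  cochain_x0 : forall x, cochain_fun x 0 = 1 }.

Record cocycle3 (K : fieldType) (G : finZmodType) := Cocycle3 {
  cocycle_fun :> G -> G -> G -> K;
  cocycle_neq0 : forall x y z, cocycle_fun x y z != 0;
  cocycleP : forall x y z t,
    cocycle_fun x y (z + t) * cocycle_fun (x + y) z t
    = cocycle_fun y z t * cocycle_fun x (y + z) t * cocycle_fun x y z;
  cocycle_0yz : forall y z, cocycle_fun 0 y z = 1;
  cocycle_x0z : forall x z, cocycle_fun x 0 z = 1;
  cocycle_xy0 : forall x y, cocycle_fun x y 0 = 1 }.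

Section Coboundary.
Variables (K : fieldType) (G : finZmodType) (F : cochain2 K G).

Definition cobound (x y z : G) : K :=
  (F x y * F (x + y) z) / (F x (y + z) * F y z).

Fact cobound_neq0 x y z : cobound x y z != 0.
Proof. by rewrite /cobound !mulf_neq0 ?invr_neq0 ?mulf_neq0 ?cochain_neq0. Qed.

Fact coboundP x y z t :
  cobound x y (z + t) * cobound (x + y) z t
  = cobound y z t * cobound x (y + z) t * cobound x y z.
Proof. by rewrite /cobound !addrA; field; rewrite !cochain_neq0. Qed.

Fact cobound_0yz y z : cobound 0 y z = 1.
Proof. by rewrite /cobound !add0r !cochain_0x !mul1r divff ?cochain_neq0. Qed.

Fact cobound_x0z x z : cobound x 0 z = 1.
Proof.
by rewrite /cobound add0r addr0 cochain_0x cochain_x0 mul1r mulr1 divff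
  ?cochain_neq0.
Qed.

Fact cobound_xy0 x y : cobound x y 0 = 1.
Proof. by rewrite /cobound !addr0 !cochain_x0 !mulr1 divff ?cochain_neq0. Qed.

Definition coboundary : cocycle3 K G :=
  Cocycle3 cobound_neq0 coboundP cobound_0yz cobound_x0z cobound_xy0.
End Coboundary.

Section TrivialCocycle.
Variables (K : fieldType) (G : finZmodType).
Let one3 (_ _ _ : G) : K := 1.

Fact trivial_neq0 x y z : one3 x y z != 0.
Proof. exact: oner_neq0. Qed.

Fact trivialP x y z t :
  one3 x y (z + t) * one3 (x + y) z t = one3 y z t * one3 x (y + z) t * one3 x y z.
Proof. by rewrite /one3 !mul1r. Qed.

Definition trivial_cocycle : cocycle3 K G :=
  Cocycle3 trivial_neq0 trivialP (fun _ _ => erefl) (fun _ _ => erefl)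
    (fun _ _ => erefl).
End TrivialCocycle.

Section Vec.
Variables (K : fieldType) (G : finZmodType) (Phi : cocycle3 K G).
Local Notation C := (gvect_cat K G).

Definition vec_tmor (U U' V V' : C) (f : hom U U') (g : hom V V') :
  hom (gtensor U V : C) (gtensor U' V') := ghom_tensor f g.
Definition vec_lunit (U : C) : hom (gtensor (gunit K G) U : C) U := glunit U.
Definition vec_runit (U : C) : hom (gtensor U (gunit K G) : C) U := grunit U.
Definition vec_assoc (U V W : C) :
    hom (gtensor (gtensor U V) W : C) (gtensor U (gtensor V W)) :=
  gassoc Phi U V W.

Fact vec_tmor1 (U V : C) : vec_tmor (idm U) (idm V) = idm (gtensor U V : C).
Proof.
apply: ghom_inj; apply: (@tens_ext _ U V) => u v.
by rewrite lfun_tensorE /= !id_lfunE.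
Qed.

Fact vec_tmorM (U U' U'' V V' V'' : C) (f' : hom U' U'') (f : hom U U')
    (g' : hom V' V'') (g : hom V V') :
  vec_tmor (f' \o f) (g' \o g) = vec_tmor f' g' \o vec_tmor f g.
Proof.
apply: ghom_inj; apply: (@tens_ext _ U V) => u v.
by rewrite /= comp_lfunE !lfun_tensorE !comp_lfunE.
Qed.

Fact vec_assoc_iso U V W : is_iso (vec_assoc U V W).
Proof.
exists (gassocV (fun x y z => (Phi x y z)^-1) U V W : hom (_ : C) _).
split; apply: ghom_inj; [apply: (@gext3 _ _ U V W)|apply: (@gext3r _ _ U V W)]
  => x y z u v w ux vy wz; rewrite comp_lfunE id_lfunE /=.
- rewrite (assoc_lfunE _ ux vy wz) linearZ /= (assocV_lfunE _ ux vy wz).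
  by rewrite scalerA divff ?cocycle_neq0 ?scale1r.
- rewrite (assocV_lfunE _ ux vy wz) linearZ /= (assoc_lfunE _ ux vy wz).
  by rewrite scalerA mulVf ?cocycle_neq0 ?scale1r.
Qed.

Fact lunitV_deg (U : gvect K G) :
  @degree_preserving _ _ U (gtensor (gunit K G) U) (tensr U (1 : K^o)).
Proof.
apply: (@ghomP _ _ U (gtensor (gunit K G) U)) => x u ux; rewrite tensrE.
by have := tensor_gr_mem (@gunit0 K G 1) ux; rewrite add0r.
Qed.

Fact runitV_deg (U : gvect K G) :
  @degree_preserving _ _ U (gtensor U (gunit K G)) (tensl U (1 : K^o)).
Proof.
apply: (@ghomP _ _ U (gtensor U (gunit K G))) => x u ux; rewrite tenslE.
by have := tensor_gr_mem ux (@gunit0 K G 1); rewrite addr0.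
Qed.

Fact vec_lunit_iso (U : C) :
  is_iso (vec_lunit U).
Proof.
exists (GHom (lunitV_deg U)); split; apply: ghom_inj.
  apply: (@tens_ext _ K^o U) => r u.
  rewrite comp_lfunE id_lfunE /= lunitE tensrE tensZr -tensZl.
  by congr tens; exact: mulr1.
by apply/lfunP=> u; rewrite comp_lfunE id_lfunE /= tensrE lunitE scale1r.
Qed.

Fact vec_runit_iso (U : C) :
  is_iso (vec_runit U).
Proof.
exists (GHom (runitV_deg U)); split; apply: ghom_inj.
  apply: (@tens_ext _ U K^o) => u r.
  rewrite comp_lfunE id_lfunE /= runitE tenslE tensZl -tensZr.
  by congr tens; exact: mulr1.
by apply/lfunP=> u; rewrite comp_lfunE id_lfunE /= tenslE runitE scale1r.
Qed.

Fact vec_assoc_nat (U U' V V' W W' : C)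
    (f : hom U U') (g : hom V V') (h : hom W W') :
  vec_assoc U' V' W' \o (vec_tmor (vec_tmor f g) h) =
  (vec_tmor f (vec_tmor g h)) \o vec_assoc U V W.
Proof.
apply: ghom_inj; apply: (@gext3 _ _ U V W) => x y z u v w ux vy wz.
rewrite !comp_lfunE /= !lfun_tensorE (assoc_lfunE _ ux vy wz) linearZ /=.
rewrite !lfun_tensorE.
by rewrite (assoc_lfunE _ (ghom_mem f ux) (ghom_mem g vy) (ghom_mem h wz)).
Qed.

Fact vec_lunit_nat (U U' : C) (f : hom U U') :
  vec_lunit U' \o (vec_tmor (idm (gunit K G : C)) f) =
  f \o vec_lunit U.
Proof.
apply: ghom_inj; apply: (@tens_ext _ K^o U) => r u.
by rewrite !comp_lfunE /= lfun_tensorE !lunitE id_lfunE linearZ.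
Qed.

Fact vec_runit_nat (U U' : C) (f : hom U U') :
  vec_runit U' \o (vec_tmor f (idm (gunit K G : C))) =
  f \o vec_runit U.
Proof.
apply: ghom_inj; apply: (@tens_ext _ U K^o) => u r.
by rewrite !comp_lfunE /= lfun_tensorE !runitE id_lfunE linearZ.
Qed.

Fact vec_pentagon (U V W X : C) :
  vec_assoc U V (gtensor W X) \o vec_assoc (gtensor U V) W X =
  (vec_tmor (idm U) (vec_assoc V W X))
  \o (vec_assoc U (gtensor V W) X
      \o (vec_tmor (vec_assoc U V W) (idm X))).
Proof.
apply: ghom_inj; apply: (@gext4 _ _ U V W X) => x y z t u v w s ux vy wz st.
have uv := tensor_gr_mem ux vy; have vw := tensor_gr_mem vy wz.
have ws := tensor_gr_mem wz st.
rewrite !comp_lfunE /= lfun_tensorE id_lfunE.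
rewrite (@assoc_lfunE _ _ _ (gtensor U V) W X _ _ _ _ _ _ uv wz st) linearZ /=.
rewrite (@assoc_lfunE _ _ _ U V (gtensor W X) _ _ _ _ _ _ ux vy ws).
rewrite (assoc_lfunE _ ux vy wz) tensZl !linearZ /=.
rewrite (@assoc_lfunE _ _ _ U (gtensor V W) X _ _ _ _ _ _ ux vw st).
rewrite [X in _ = _ *: X]linearZ /= lfun_tensorE id_lfunE (assoc_lfunE _ vy wz st) tensZr.
rewrite !scalerA; congr (_ *: _).
by rewrite cocycleP; ring.
Qed.

Fact vec_triangle (U V : C) :
  (vec_tmor (idm U) (vec_lunit V))
    \o vec_assoc U (gunit K G) V
  = (vec_tmor (vec_runit U) (idm V)).
Proof.
apply: ghom_inj; apply: (@gext3 _ _ U (gunit K G) V) => x y z u r v ux ry vz.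
rewrite comp_lfunE /= lfun_tensorE runitE id_lfunE.
rewrite (assoc_lfunE _ ux (gunit0 r) vz) cocycle_x0z scale1r.
by rewrite lfun_tensorE lunitE id_lfunE tensZl tensZr.
Qed.

Definition Vec : tensor_category :=
  @TensorCategory C (@gtensor K G) (@vec_tmor) (gunit K G)
    vec_assoc vec_lunit vec_runit
    vec_tmor1 vec_tmorM vec_assoc_iso vec_lunit_iso vec_runit_iso
    vec_assoc_nat vec_lunit_nat vec_runit_nat vec_pentagon vec_triangle.

End Vec.

Section Algebras.
Variables (K : fieldType) (G : finZmodType).

Definition alg_space (Phi : cocycle3 K G) (A : algebra_data (Vec Phi)) :
  gvect K G := acarrier A.

Definition alg_mul (Phi : cocycle3 K G) (A : algebra_data (Vec Phi))
    (a b : alg_space A) : alg_space A :=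
  (amul A : ghom (gtensor (alg_space A) (alg_space A)) (alg_space A)) (tens a b).

Definition alg_one (Phi : cocycle3 K G) (A : algebra_data (Vec Phi)) :
    alg_space A :=
  (aunit A : ghom (gunit K G) (alg_space A)) (1 : K^o).

Record is_algebra (Phi : cocycle3 K G) (A : algebra_data (Vec Phi)) : Prop :=
    IsAlgebra {
  alg_mulA : forall (x y z : G) (a b c : alg_space A),
    a \in gr (alg_space A) x -> b \in gr (alg_space A) y ->
    c \in gr (alg_space A) z ->
    alg_mul (alg_mul a b) c = Phi x y z *: alg_mul a (alg_mul b c);
  alg_mul1l : forall a : alg_space A, alg_mul (alg_one A) a = a;
  alg_mul1r : forall a : alg_space A, alg_mul a (alg_one A) = a }.

Record algebra (Phi : cocycle3 K G) := Algebra {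
  alg_data :> algebra_data (Vec Phi);
  algP : is_algebra alg_data }.

Section TwistedGroupAlgebra.
Variable F : cochain2 K G.

(* The basis element indexed by x. *)
Definition gbasis (x : G) : {ffun G -> K^o} := [ffun y => (y == x)%:R].

Definition tga_gr (x : G) : {vspace {ffun G -> K^o}} := <[gbasis x]>%VS.

Lemma gbasis_sum (a : {ffun G -> K^o}) : a = \sum_x (a x : K) *: gbasis x.
Proof.
apply/ffunP=> y; rewrite sum_ffunE (bigD1 y) //= big1 => [|x xy].
  by rewrite !ffunE eqxx addr0 [RHS]mulr1.
by rewrite !ffunE eq_sym (negPf xy) scaler0.
Qed.

Fact tga_full : (\sum_x tga_gr x)%VS = fullv.
Proof.
apply/eqP; rewrite eqEsubv subvf; apply/subvP=> a _; rewrite (gbasis_sum a).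
apply: memv_suml => x _; apply: memvZ.
by apply/(subvP _ _ (memv_line (gbasis x))); apply: (sumv_sup x).
Qed.

Fact tga_direct : direct_family tga_gr.
Proof.
apply/directv_sum_independent => us usP us0 x _.
have us_y y : exists k : K, us y = k *: gbasis y by apply/vlineP; apply: usP.
have [k uE] := us_y x; have /ffunP/(_ x) := us0.
rewrite sum_ffunE (bigD1 x) //= big1 => [|y yx].
  by rewrite uE !ffunE eqxx addr0 [_ *: _]mulr1 => ->; rewrite scale0r.
by have [l ->] := us_y y; rewrite !ffunE eq_sym (negPf yx) scaler0.
Qed.

Definition tga_space : gvect K G := GVect tga_full tga_direct.

Definition tga_prod (a b : {ffun G -> K^o}) : {ffun G -> K^o} :=
  \sum_x \sum_y (a x * b y * F x y : K) *: gbasis (x + y).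

Fact tga_prod_bilin : bilin tga_prod.
Proof.
split=> [b|b] k s t; rewrite /tga_prod scaler_sumr -big_split;
  apply: eq_bigr => x _; rewrite scaler_sumr -big_split; apply: eq_bigr => y _ /=;
  rewrite !ffunE scalerA -scalerDl; congr (_ *: _);
  rewrite [X in X + _]/GRing.scale /=; ring.
Qed.

Lemma tga_prodE x y : tga_prod (gbasis x) (gbasis y) = F x y *: gbasis (x + y).
Proof.
rewrite /tga_prod (bigD1 x) //= (bigD1 y) //= !big1 ?addr0.
- by rewrite !ffunE !eqxx !mul1r.
- by move=> z zx; rewrite big1 // => t _; rewrite !ffunE (negPf zx) !mul0r scale0r.
- by move=> z zy; rewrite !ffunE (negPf zy) mulr0 mul0r scale0r.
Qed.

Definition tga_mul_lfun : 'Hom(tspace tga_space tga_space, tga_space) :=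
  tlift tga_prod.

Lemma tga_mulE a b : tga_mul_lfun (tens a b) = tga_prod a b.
Proof. exact: tliftE tga_prod_bilin. Qed.

Lemma tga_prodZl k (a b : {ffun G -> K^o}) :
  tga_prod (k *: a) b = k *: tga_prod a b.
Proof. by rewrite -!tga_mulE (@tensZl K tga_space tga_space) linearZ. Qed.

Lemma tga_prodZr k (a b : {ffun G -> K^o}) :
  tga_prod a (k *: b) = k *: tga_prod a b.
Proof. by rewrite -!tga_mulE (@tensZr K tga_space tga_space) linearZ. Qed.

Fact tga_mul_deg :
  @degree_preserving _ _ (gtensor tga_space tga_space) tga_space tga_mul_lfun.
Proof.
apply: (@ghomP _ _ (gtensor tga_space tga_space) tga_space) => z t.
apply: tensor_gr_img => x y u v <- /vlineP[k ->] /vlineP[l ->].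
by rewrite tga_mulE tga_prodZl tga_prodZr tga_prodE !memvZ // memv_line.
Qed.

Definition tga_one_lfun : 'Hom(K^o, {ffun G -> K^o}) :=
  linfun (fun r : K^o => (r : K) *: gbasis 0).

Lemma tga_oneE r : tga_one_lfun r = (r : K) *: gbasis 0.
Proof.
have lin : linear (fun r : K^o => (r : K) *: gbasis 0).
  by move=> k s t; rewrite scalerDl -scalerA.
pose h : {linear K^o -> {ffun G -> K^o}} := HB.pack
  (fun r : K^o => (r : K) *: gbasis 0) (GRing.isLinear.Build _ _ _ _ _ lin).
exact: (lfunE h).
Qed.

Fact tga_one_deg : @degree_preserving _ _ (gunit K G) tga_space tga_one_lfun.
Proof.
apply: (@ghomP _ _ (gunit K G) tga_space) => x r rx; rewrite tga_oneE.
case: (gunitP rx) => ->; last by rewrite scale0r mem0v.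
by rewrite memvZ // memv_line.
Qed.

(* The objects and morphisms involved do not depend on Phi. *)
Definition twisted_group_algebra_data (Phi : cocycle3 K G) :
    algebra_data (Vec Phi) :=
  @AlgebraData (Vec Phi) tga_space (GHom tga_mul_deg) (GHom tga_one_deg).

Fact twisted_group_algebraP (Phi : cocycle3 K G) :
  (forall x y z, Phi x y z = coboundary F x y z) -> is_algebra (twisted_group_algebra_data Phi).
Proof.
move=> PhiE; split=> [x y z a b c|a|a].
- move=> /vlineP[k ->] /vlineP[l ->] /vlineP[m ->].
  rewrite /alg_mul /= !tga_mulE.
  rewrite !(tga_prodZl, tga_prodZr, tga_prodE, scalerA) addrA PhiE.
  congr (_ *: _); rewrite /= /cobound; field.
  by rewrite !cochain_neq0.
- rewrite /alg_mul /alg_one /= tga_oneE scale1r tga_mulE /tga_prod.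
  rewrite (bigD1 0) //= [X in _ + X]big1 ?addr0 => [|x x0]; last first.
    by rewrite big1 // => y _; rewrite !ffunE (negPf x0) !mul0r scale0r.
  rewrite [RHS]gbasis_sum; apply: eq_bigr => y _.
  by rewrite add0r ffunE eqxx cochain_0x mul1r mulr1.
- rewrite /alg_mul /alg_one /= tga_oneE scale1r tga_mulE /tga_prod.
  rewrite [RHS]gbasis_sum; apply: eq_bigr => x _.
  rewrite (bigD1 0) //= [X in _ + X]big1 ?addr0 => [|y y0]; last first.
    by rewrite !ffunE (negPf y0) mulr0 mul0r scale0r.
  by rewrite ffunE eqxx cochain_x0 !mulr1.
Qed.

(* The algebra K_F[G] in Vec_G^Phi, where Phi is the coboundary of F. *)
Definition twisted_group_algebra (Phi : cocycle3 K G)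
    (PhiE : (forall x y z, Phi x y z = coboundary F x y z)) : algebra Phi :=
  Algebra (twisted_group_algebraP PhiE).

End TwistedGroupAlgebra.
End Algebras.

Definition Z23 : finZmodType := 'rV['Z_2]_3.

(* The coordinates x_1, x_2, x_3 of x are [bit x 0], [bit x 1], [bit x 2], as
   natural numbers 0 or 1. *)
Definition bit (x : Z23) (i : 'I_3) : nat := (x : 'rV['Z_2]_3) 0 i.
Arguments bit x%_R i%_R.

Definition cubic_form (x y : Z23) : nat :=
  (bit x 0 * bit x 1 * bit y 2 + bit x 0 * bit y 1 * bit x 2
   + bit y 0 * bit x 1 * bit x 2)%N.

Definition quadratic_form (x y : Z23) : nat :=
  (\sum_(i < 3) \sum_(j < 3 | i <= j) bit x i * bit y j)%N.

Section OctonionsClifford.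
Variable R : realType.

Definition oct_fun (x y : Z23) : R :=
  (-1) ^+ (cubic_form x y + quadratic_form x y).

Definition cl_fun (x y : Z23) : R := (-1) ^+ quadratic_form x y.

Lemma bit0 i : bit 0 i = 0%N.
Proof. by rewrite /bit mxE. Qed.

Lemma odd_bitD x y i : odd (bit (x + y) i) = odd (bit x i) (+) odd (bit y i).
Proof. by rewrite /bit mxE /= modn2 oddb oddD. Qed.

Fact cubic_form0x x : cubic_form 0 x = 0%N.
Proof. by rewrite /cubic_form !bit0 !mul0n !muln0. Qed.

Fact cubic_formx0 x : cubic_form x 0 = 0%N.
Proof. by rewrite /cubic_form !bit0 !mul0n !muln0. Qed.

Fact quadratic_form0x x : quadratic_form 0 x = 0%N.
Proof. by rewrite /quadratic_form !big1 // => i _; rewrite big1 // => j _; rewrite bit0. Qed.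

Fact quadratic_formx0 x : quadratic_form x 0 = 0%N.
Proof.
by rewrite /quadratic_form !big1 // => i _; rewrite big1 // => j _;
  rewrite bit0 muln0.
Qed.

Fact odd_quadratic_formDl x y z : odd (quadratic_form (x + y) z) =
  odd (quadratic_form x z) (+) odd (quadratic_form y z).
Proof.
rewrite /quadratic_form -oddD -big_split /=.
rewrite !(big_morph odd oddD (erefl : odd 0 = false)); apply: eq_bigr => i _.
rewrite -big_split /= !(big_morph odd oddD (erefl : odd 0 = false)).
by apply: eq_bigr => j _; rewrite oddD !oddM odd_bitD andb_addl.
Qed.

Fact odd_quadratic_formDr x y z : odd (quadratic_form x (y + z)) =
  odd (quadratic_form x y) (+) odd (quadratic_form x z).
Proof.
rewrite /quadratic_form -oddD -big_split /=.
rewrite !(big_morph odd oddD (erefl : odd 0 = false)); apply: eq_bigr => i _.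
rewrite -big_split /= !(big_morph odd oddD (erefl : odd 0 = false)).
by apply: eq_bigr => j _; rewrite oddD !oddM odd_bitD andb_addr.
Qed.

Fact oct_neq0 x y : oct_fun x y != 0.
Proof. by rewrite signr_eq0. Qed.
Fact oct_0x x : oct_fun 0 x = 1.
Proof. by rewrite /oct_fun cubic_form0x quadratic_form0x. Qed.
Fact oct_x0 x : oct_fun x 0 = 1.
Proof. by rewrite /oct_fun cubic_formx0 quadratic_formx0. Qed.
Definition oct_cochain : cochain2 R Z23 := Cochain2 oct_neq0 oct_0x oct_x0.

Fact cl_neq0 x y : cl_fun x y != 0.
Proof. by rewrite signr_eq0. Qed.
Fact cl_0x x : cl_fun 0 x = 1.
Proof. by rewrite /cl_fun quadratic_form0x. Qed.
Fact cl_x0 x : cl_fun x 0 = 1.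
Proof. by rewrite /cl_fun quadratic_formx0. Qed.
Definition cl_cochain : cochain2 R Z23 := Cochain2 cl_neq0 cl_0x cl_x0.

Lemma cl_funDl x y z : cl_fun (x + y) z = cl_fun x z * cl_fun y z.
Proof.
rewrite /cl_fun -signr_odd odd_quadratic_formDl signr_addb.
by rewrite !signr_odd.
Qed.

Lemma cl_funDr x y z : cl_fun x (y + z) = cl_fun x y * cl_fun x z.
Proof.
rewrite /cl_fun -signr_odd odd_quadratic_formDr signr_addb.
by rewrite !signr_odd.
Qed.

Lemma coboundary_cl x y z :
  trivial_cocycle R Z23 x y z = coboundary cl_cochain x y z.
Proof.
rewrite -[RHS]/((cl_fun x y * cl_fun (x + y) z) /
                (cl_fun x (y + z) * cl_fun y z)).
by rewrite cl_funDl cl_funDr mulrA divff // !mulf_neq0 ?cl_neq0.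
Qed.

Definition octonions : algebra (coboundary oct_cochain) :=
  twisted_group_algebra (F := oct_cochain) (fun _ _ _ => erefl).

Definition Cl03 : algebra (trivial_cocycle R Z23) :=
  twisted_group_algebra coboundary_cl.

Definition oct_phi2 (U V : gvect R Z23) : ghom (gtensor U V) (gtensor U V) :=
  gtwist (fun x y => (-1) ^+ cubic_form x y) U V.

Lemma oct_phi2E (U V : gvect R Z23) x y u v : u \in gr U x -> v \in gr V y ->
  oct_phi2 U V (tens u v) = (-1) ^+ cubic_form x y *: tens u v.
Proof. exact: twistE. Qed.

Definition oct_functor :
    tensor_triple (Vec (coboundary oct_cochain)) (Vec (trivial_cocycle R Z23)) :=
  @TensorTriple (Vec (coboundary oct_cochain)) (Vec (trivial_cocycle R Z23))
    (id_functor (gvect_cat R Z23)) (id_ghom (gunit R Z23)) oct_phi2.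

End OctonionsClifford.

(* Main.v *)
(** A 2-cochain [c] twists the identity functor of graded spaces into a tensor
    functor [Vec_G^Phi -> Vec_G^Phi'] as soon as [Phi * dc = Phi'], and the cochain
    [1/c] gives the inverse.  This functor sends the twisted group algebra of [F]
    to that of [F * c].  For the octonions [c] is the cubic sign and [F = c * F'], so
    [c^2 = 1] gives [F * c = F'] and [dF * dc = dF' = 1]. *)
Require Import Defs.
From mathcomp Require Import all_boot all_order all_algebra.
From mathcomp Require Import ring reals.

Set Implicit Arguments.
Unset Strict Implicit.
Unset Printing Implicit Defensive.

Import GRing.Theory.
Local Open Scope ring_scope.
Local Open Scope cat_scope.

Lemma idm_iso (C : category) (U : C) : is_iso (idm U).
Proof. by exists (idm U); rewrite comp1m. Qed.

Section TwistFunctor.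
Variables (K : fieldType) (G : finZmodType).
Implicit Types (c d : cochain2 K G) (Phi Psi : cocycle3 K G) (U V W : gvect K G).

Definition twist_functor Phi Psi c : tensor_triple (Vec Phi) (Vec Psi) :=
  @TensorTriple (Vec Phi) (Vec Psi) (id_functor (gvect_cat K G))
    (id_ghom (gunit K G)) (gtwist c).

(** Twists act on homogeneous tensors by scalars, and scalars multiply. A pointwise equation for [e]
    avoids any equality between functions. *)
Lemma gtwistM (c d e : G -> G -> K) U V :
  (forall x y, c x y * d x y = e x y) ->
  comp_ghom (gtwist c U V) (gtwist d U V) = gtwist e U V.
Proof.
move=> cde; apply: ghom_inj; apply: (@gext2 _ _ U V) => x y u v ux vy.
rewrite comp_lfunE /= !(twistE _ ux vy) linearZ /= (twistE _ ux vy) scalerA.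
by rewrite mulrC cde.
Qed.

Lemma gtwist1 (c : G -> G -> K) U V :
  (forall x y, c x y = 1) -> gtwist c U V = id_ghom (gtensor U V).
Proof.
move=> c1; apply: ghom_inj; apply: (@gext2 _ _ U V) => x y u v ux vy.
by rewrite /= (twistE _ ux vy) c1 scale1r id_lfunE.
Qed.

Lemma gtwist_inv (c d : G -> G -> K) U V :
  (forall x y, c x y * d x y = 1) ->
  comp_ghom (gtwist c U V) (gtwist d U V) = id_ghom (gtensor U V).
Proof. by move=> cd1; rewrite (gtwistM _ _ cd1) gtwist1. Qed.

Fact inv_cochain_neq0 c x y : (c x y)^-1 != 0.
Proof. by rewrite invr_neq0 ?cochain_neq0. Qed.
Fact inv_cochain_0x c x : (c 0 x)^-1 = 1.
Proof. by rewrite cochain_0x invr1. Qed.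
Fact inv_cochain_x0 c x : (c x 0)^-1 = 1.
Proof. by rewrite cochain_x0 invr1. Qed.
Definition inv_cochain c : cochain2 K G :=
  Cochain2 (inv_cochain_neq0 c) (inv_cochain_0x c) (inv_cochain_x0 c).

(** Naturality holds because morphisms preserve degrees, and the unit axioms because [c] is
    normalized. Only associativity involves [Phi] and [Psi]. *)
Lemma twist_functor_tensor Phi Psi c :
  (forall x y z, Phi x y z * coboundary c x y z = Psi x y z) ->
  is_tensor_functor (twist_functor Phi Psi c).
Proof.
move=> PhiPsi; split=> [|U V|U U' V V' f g|U V W|U|U].
- exact: idm_iso.
- exists (gtwist (inv_cochain c) U V).
  by split; apply: gtwist_inv => x y /=; rewrite ?mulVf ?divff ?cochain_neq0.
- apply: ghom_inj; apply: (@gext2 _ _ U V) => x y u v ux vy.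
  rewrite !comp_lfunE /= (twistE _ ux vy) linearZ /= lfun_tensorE.
  exact: (twistE _ (ghom_mem f ux) (ghom_mem g vy)).
- apply: ghom_inj; apply: (@gext3 _ _ U V W) => x y z u v w ux vy wz.
  have uv := tensor_gr_mem ux vy; have vw := tensor_gr_mem vy wz.
  rewrite !comp_lfunE /= lfun_tensorE /= id_lfunE (twistE _ ux vy) tensZl.
  rewrite !linearZ /= (@twistE _ _ _ (gtensor U V) W _ _ _ _ uv wz) linearZ /=.
  rewrite !(assoc_lfunE _ ux vy wz) !linearZ /= lfun_tensorE id_lfunE.
  rewrite (twistE _ vy wz) tensZr [X in _ = _ *: X]linearZ /=.
  rewrite (@twistE _ _ _ U (gtensor V W) _ _ _ _ ux vw) !scalerA.
  (* Both sides are now multiples of [tens u (tens v w)]: the scalars agree when [Phi x y z * c x y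
     * c (x + y) z = c x (y + z) * c y z * Psi x y z]. *)
  congr (_ *: _); rewrite -PhiPsi /= /cobound; field.
  by rewrite !cochain_neq0.
- apply: ghom_inj; apply: (@gext2 _ _ (gunit K G) U) => x y r u rx uy.
  rewrite !comp_lfunE /= lfun_tensorE !id_lfunE.
  (* A nonzero scalar has degree 0, where [c 0 y = 1]. *)
  case: (gunitP rx) => [_|->]; last by rewrite tens0l !linear0.
  by rewrite (twistE _ (gunit0 r) uy) cochain_0x scale1r.
- apply: ghom_inj; apply: (@gext2 _ _ U (gunit K G)) => x y u r ux ry.
  rewrite !comp_lfunE /= lfun_tensorE !id_lfunE.
  case: (gunitP ry) => [_|->]; last by rewrite tens0r !linear0.
  by rewrite (twistE _ ux (gunit0 r)) cochain_x0 scale1r.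
Qed.

(** The scalars of [c] and [d] cancel, so the structure maps of [H] are identities and identity
    components form the isomorphism. An equivalence asks for opposite directions on its two sides,
    hence the two conclusions. *)
Lemma comp_twist_functor_iso Phi Psi c d :
  (forall x y, d x y * c x y = 1) ->
  let H := comp_tensor (twist_functor Psi Phi d) (twist_functor Phi Psi c) in
  tensor_isomorphic H (id_tensor (Vec Phi)) /\
  tensor_isomorphic (id_tensor (Vec Phi)) H.
Proof.
move=> dc1 H.
have H2 (U V : Vec Phi) : phi2 H U V = idm (U \ox V).
  by apply: gtwist_inv => x y; rewrite mulrC.
have H0 : phi0 H = idm tone by exact: comp1_ghom.
have id2 (U V : Vec Phi) : idm (U \ox V) \o (idm U \oxm idm V) = idm (U \ox V).
  by rewrite comp1m tmor1.
split; exists (fun U => idm (U : Vec Phi)); split=> [U|U V f||U V].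
- exact: idm_iso.
- by rewrite comp1m compm1.
- by rewrite comp1m; exact: H0.
- by rewrite comp1m; exact: (etrans (H2 U V) (esym (id2 U V))).
- exact: idm_iso.
- by rewrite comp1m compm1.
- by rewrite comp1m; exact: (esym H0).
- rewrite comp1m [phi2 H U V]H2; exact: (esym (id2 U V)).
Qed.

Lemma twist_functor_equivalence Phi Psi c :
  (forall x y z, Phi x y z * coboundary c x y z = Psi x y z) ->
  is_tensor_equivalence (twist_functor Phi Psi c).
Proof.
move=> PhiPsi; split; first exact: twist_functor_tensor.
have cV x y : c x y * inv_cochain c x y = 1 by rewrite divff ?cochain_neq0.
have Vc x y : inv_cochain c x y * c x y = 1 by rewrite mulrC cV.
exists (twist_functor Psi Phi (inv_cochain c)); split.
(* The coboundary of [1/c] is the inverse of that of [c], which turns [Psi] back into [Phi]. *)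
- apply: twist_functor_tensor => x y z.
  by rewrite -PhiPsi /= /cobound /=; field; rewrite oner_neq0 !cochain_neq0.
- by have [] := comp_twist_functor_iso Phi Psi Vc.
- by have [] := comp_twist_functor_iso Psi Phi cV.
Qed.

Lemma coboundaryM (F F' : cochain2 K G) c :
  (forall x y, F x y * c x y = F' x y) ->
  forall x y z, coboundary F x y z * coboundary c x y z = coboundary F' x y z.
Proof.
move=> FcF' x y z; rewrite /= /cobound -!FcF'.
by field; rewrite !cochain_neq0.
Qed.

(** Applying [phi2] before multiplying scales the product of the basis elements [x] and [y] by
    [c x y]. Carrier and unit stay the same, so this is an equality and not just an isomorphism. *)
Lemma image_twisted_group_algebra_data Phi Psi c (F F' : cochain2 K G) :
  (forall x y, F x y * c x y = F' x y) ->
  image_algebra (twist_functor Phi Psi c) (twisted_group_algebra_data F Phi)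
  = twisted_group_algebra_data F' Psi.
Proof.
move=> FcF'; congr (@AlgebraData (Vec Psi) (tga_space K G) _ _).
  apply: ghom_inj; apply: (@gext2 _ _ (tga_space K G) (tga_space K G)).
  move=> x y a b a_x b_y; rewrite comp_lfunE /= (twistE _ a_x b_y) linearZ /= !tga_mulE.
  case/vlineP: a_x => k ->; case/vlineP: b_y => l ->.
  rewrite !(tga_prodZl, tga_prodZr) !tga_prodE !scalerA -FcF'.
  by congr (_ *: _); ring.
by apply: ghom_inj; rewrite /= comp_lfun1r.
Qed.

End TwistFunctor.

Section OctonionsClifford.
Variable R : realType.

Let cubic_sign (x y : Z23) : R := (-1) ^+ cubic_form x y.

Fact cubic_neq0 x y : cubic_sign x y != 0.
Proof. by rewrite signr_eq0. Qed.
Fact cubic_0x x : cubic_sign 0 x = 1.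
Proof. by rewrite /cubic_sign cubic_form0x. Qed.
Fact cubic_x0 x : cubic_sign x 0 = 1.
Proof. by rewrite /cubic_sign cubic_formx0. Qed.
Definition cubic_cochain : cochain2 R Z23 := Cochain2 cubic_neq0 cubic_0x cubic_x0.

Lemma oct_cochainM x y :
  oct_cochain R x y = cubic_cochain x y * cl_cochain R x y.
Proof. exact: exprD. Qed.

Lemma cubic_cochain_sqr x y : cubic_cochain x y * cubic_cochain x y = 1.
Proof. by rewrite /= /cubic_sign -expr2 sqrr_sign. Qed.

Lemma oct_cochain_cubic x y :
  oct_cochain R x y * cubic_cochain x y = cl_cochain R x y.
Proof. by rewrite oct_cochainM mulrAC cubic_cochain_sqr mul1r. Qed.

Lemma coboundary_oct_cubic x y z :
  coboundary (oct_cochain R) x y z * coboundary cubic_cochain x y z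
  = trivial_cocycle R Z23 x y z.
Proof.
(* [coboundary_cl] rests on [cl_fun] being multiplicative in each argument. *)
by rewrite coboundary_cl; apply: coboundaryM; exact: oct_cochain_cubic.
Qed.

End OctonionsClifford.

Theorem proposition1p1 (R : realType) :
  is_tensor_equivalence (oct_functor R) /\
  image_algebra (oct_functor R) (octonions R)
    = Cl03 R :> algebra_data (Vec (trivial_cocycle R Z23)).
Proof.
split.
  (* [oct_functor R] is convertible to [twist_functor] at [cubic_cochain R]. *)
  exact: (twist_functor_equivalence (@coboundary_oct_cubic R)).
exact: (image_twisted_group_algebra_data _ _ (@oct_cochain_cubic R)).
Qed.
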